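(* Let $u\in\mathbb{R}^n_{++}$ and $\mu\in\mathbb{R}$ be such that $\mu(1-\gamma)>0$, and define $$v(k)=\frac{1}{1-\gamma}\left[\frac{\gamma}{\mu(1-\gamma)}\right]^\gamma\langle k,u\rangle^{1-\gamma},\qquad k\in\mathbb{R}^n_{++}.$$ If $L$ is irreducible and the pair $(\mu,u)$ is a solution to the nonlinear eigenvalue problem $$(L+A)u=\left[\frac{\rho}{1-\gamma}-\mu\,\Phi(u)\right]u,\qquad \Phi(u)=\sum_{i=1}^np_i^{\frac1\gamma}u_i^{\frac{\gamma-1}{\gamma}},$$ then $v$ is a classical solution on $\mathbb{R}^n_{++}$ of the Hamilton–Jacobi–Bellman equation, i.e. $v\in C^1(\mathbb{R}^n_{++})$ and $$\rho v(k)=\langle (L+A)k,\mathrm{D}v(k)\rangle+H_\gamma(\mathrm{D}v(k))\qquad\text{for all }k\in\mathbb{R}^n_{++}.$$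
   Context: $\mathbb{R}^n_+$ and $\mathbb{R}^n_{++}$ are the sets of vectors in $\mathbb{R}^n$ with all components $\ge 0$, resp. $>0$. Here $n\ge2$, $\rho>0$, $\gamma>0$ with $\gamma\ne1$, $p_1,\dots,p_n>0$, $A=\mathrm{diag}(A_1,\dots,A_n)$ with $A_i>0$. $W=(w_{ij})$ is a symmetric matrix of graph weights with $w_{ij}\ge0$, $w_{ii}=0$, and $L=(\ell_{ij})$ is given by $\ell_{ij}=w_{ij}$ for $i\neq j$ and $\ell_{ii}=-\sum_{j\ne i}w_{ij}$. $L$ irreducible means that the graph on $\{1,\dots,n\}$ with edges $\{i,j\}$ whenever $w_{ij}>0$ is connected. The Hamiltonian is $H_\gamma(q)=\sup_{c\in\mathbb{R}^n_+}\{-\langle c,q\rangle+\sum_{i=1}^np_i\frac{c_i^{1-\gamma}}{1-\gamma}\}$, $q\in\mathbb{R}^n$ (with $c_i^{1-\gamma}/(1-\gamma)=-\infty$ for $c_i=0$, $\gamma>1$). *)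

(* Defs.v *)
From HB Require Import structures.
From mathcomp Require Import all_boot all_order all_algebra.
From mathcomp Require Import all_classical all_reals all_analysis.

Set Implicit Arguments.
Unset Strict Implicit.
Unset Printing Implicit Defensive.

Import Order.TTheory GRing.Theory Num.Theory.
Import numFieldNormedType.Exports.
Local Open Scope classical_set_scope.
Local Open Scope ring_scope.

Definition nonneg_orthant (R : realType) (n : nat) : set 'cV[R]_n :=
  [set x | forall i, 0 <= x i 0].

Definition pos_orthant (R : realType) (n : nat) : set 'cV[R]_n :=
  [set x | forall i, 0 < x i 0].

Definition inner (R : realType) (n : nat) (x y : 'cV[R]_n) : R :=
  \sum_i x i 0 * y i 0.

Definition gradient (R : realType) (n : nat) (f : 'cV[R]_n -> R)
    (x : 'cV[R]_n) : 'cV[R]_n :=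
  \col_i 'D_(delta_mx i 0) f x.

(* [U] is meant to be open: differentiability is taken in the ambient space,
   so the values of [f] outside [U] are irrelevant. *)
Definition C1_on (R : realType) (n : nat) (U : set 'cV[R]_n)
    (f : 'cV[R]_n -> R) : Prop :=
  (forall x, U x -> differentiable f x) /\ {within U, continuous (gradient f)}.

Definition graph_weights (R : realType) (n : nat) (W : 'M[R]_n) : Prop :=
  [/\ W^T = W, forall i j, 0 <= W i j & forall i, W i i = 0].

Definition graph_laplacian (R : realType) (n : nat) (W : 'M[R]_n) : 'M[R]_n :=
  \matrix_(i, j) if i == j then - \sum_(k | k != i) W i k else W i j.

Definition graph_irreducible (R : realType) (n : nat) (W : 'M[R]_n) : Prop :=
  forall i j : 'I_n, connect (fun x y : 'I_n => 0 < W x y) i j.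

Definition diag_of (R : realType) (n : nat) (a : 'I_n -> R) : 'M[R]_n :=
  diag_mx (\row_i a i).

(* x ^ (1 - gamma) / (1 - gamma) for x >= 0. The case x = 0, gamma > 1 is
   singled out because [powR] sends 0 to 0 at every nonzero exponent. *)
Definition crra (R : realType) (gamma x : R) : \bar R :=
  if (x == 0) && (1 < gamma) then -oo%E
  else (x `^ (1 - gamma) / (1 - gamma))%:E.

(* Extended-real valued: the supremum may be infinite for some [q]. *)
Definition hamiltonian (R : realType) (n : nat) (gamma : R) (p : 'I_n -> R)
    (q : 'cV[R]_n) : \bar R :=
  ereal_sup [set ((- inner c q)%R%:E + \sum_i (p i)%:E * crra gamma (c i 0%R))%E
            | c in @nonneg_orthant R n].

Definition Phi (R : realType) (n : nat) (gamma : R) (p : 'I_n -> R)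
    (u : 'cV[R]_n) : R :=
  \sum_i p i `^ gamma^-1 * u i 0 `^ ((gamma - 1) / gamma).

Definition eigen_solution (R : realType) (n : nat) (rho gamma : R)
    (p a : 'I_n -> R) (W : 'M[R]_n) (mu : R) (u : 'cV[R]_n) : Prop :=
  (graph_laplacian W + diag_of a) *m u =
  (rho / (1 - gamma) - mu * Phi gamma p u) *: u.

Definition candidate_value (R : realType) (n : nat) (gamma mu : R)
    (u k : 'cV[R]_n) : R :=
  (1 - gamma)^-1 * (gamma / (mu * (1 - gamma))) `^ gamma
    * inner k u `^ (1 - gamma).

Definition HJB_classical_solution (R : realType) (n : nat) (rho gamma : R)
    (p a : 'I_n -> R) (W : 'M[R]_n) (v : 'cV[R]_n -> R) : Prop :=
  C1_on (@pos_orthant R n) v /\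
  forall k, @pos_orthant R n k ->
    (rho * v k)%:E =
    ((inner ((graph_laplacian W + diag_of a) *m k) (gradient v k))%R%:E
     + hamiltonian gamma p (gradient v k))%E.

(* Main.v *)
(** With [B = gamma / (mu (1 - gamma))] and [s = <k, u>], the gradient of the
    candidate is [B^gamma s^(-gamma) u], which is positive. For [q > 0] the
    supremum defining the Hamiltonian splits over coordinates and is attained at
    [c_i = (p_i / q_i)^(1/gamma)], so that
    [H(q) = gamma / (1 - gamma) \sum_i p_i^(1/gamma) q_i^((gamma - 1)/gamma)],
    which at the gradient equals
    [gamma / (1 - gamma) B^(gamma - 1) s^(1 - gamma) Phi(u)]. Since [L + A] is
    symmetric, the drift term is
    [B^gamma s^(1 - gamma) (rho / (1 - gamma) - mu Phi(u))] by the eigenvalue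
    equation, and the two [Phi(u)] terms cancel by the choice of [B]. *)
Require Import Defs.
From HB Require Import structures.
From mathcomp Require Import all_boot all_order all_algebra.
From mathcomp Require Import all_classical all_reals all_analysis.
From mathcomp Require Import ring lra.
Import Order.TTheory GRing.Theory Num.Theory.
Import numFieldNormedType.Exports.
Local Open Scope classical_set_scope.
Local Open Scope ring_scope.

Section Real.
Context {R : realType}.
Implicit Types a g x t p q : R.

(* Writing [t = exp y], both signs of [a] follow from [exp y >= 1 + y],
   i.e. from the convexity of [exp]. *)
Lemma powR_div_le_tangent a t : a < 1 -> a != 0 -> 0 < t ->
  t `^ a / a <= t + (a^-1 - 1).
Proof.
move=> a1 a0 t0; have -> : t `^ a = expR (a * ln t) by rewrite /powR gt_eqF.
rewrite -[in leRHS](lnK t0); set y := ln t.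
have [apos|aneg] := ltP 0 a.
  have e1 : expR (a * y) * (1 + (1 - a) * y) <= expR y.
    have -> : expR y = expR (a * y) * expR ((1 - a) * y).
      by rewrite -expRD; congr expR; ring.
    by rewrite ler_pM2l ?expR_gt0// expR_ge1Dx.
  have e2 : expR (a * y) * (1 - a * y) <= 1.
    rewrite -[leRHS](divff (lt0r_neq0 (expR_gt0 (a * y)))) -expRN.
    by rewrite ler_pM2l ?expR_gt0// expR_ge1Dx.
  rewrite ler_pdivrMr//.
  have -> : (expR y + (a^-1 - 1)) * a = a * expR y + (1 - a) by field.
  set E := expR (a * y) in e1 e2 *.
  (* The weights [a] and [1 - a] are chosen so that the terms in [y] cancel; both are positive here,
     so [e1] and [e2] can be added with these weights. *)
  have -> : E = a * (E * (1 + (1 - a) * y)) + (1 - a) * (E * (1 - a * y)) by ring.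
  apply: lerD; first by rewrite ler_pM2l.
  by rewrite ler_piMr// subr_ge0 ltW.
have {a0}aneg : a < 0 by rewrite lt_neqAle a0.
rewrite ler_ndivrMr//.
have -> : (expR y + (a^-1 - 1)) * a = a * expR y + (1 - a) by field; lra.
have e1 := expR_ge1Dx (a * y).
have e2 : a * expR y <= a * (1 + y) by rewrite ler_nM2l// expR_ge1Dx.
lra.
Qed.

Section Crra.
Variables (g p q : R).
Hypotheses (g0 : 0 < g) (g1 : g != 1) (p0 : 0 < p) (q0 : 0 < q).

Let b := (p / q) `^ g^-1.

Let b0 : 0 < b. Proof. by rewrite powR_gt0 ?divr_gt0. Qed.

Let subg0 : 1 - g != 0. Proof. by rewrite subr_eq0 eq_sym. Qed.

(** First-order condition [p * b]^ (- g) = q[for maximizing]- x * q + p * x [^ (1 - g) / (1 - g)],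
    multiplied by [b]. *)
Let pE : p * b `^ (1 - g) = b * q.
Proof.
rewrite powRB ?(gt_eqF b0) ?implybT// (powRr1 (ltW b0)) /b -powRrM mulVf ?gt_eqF//.
rewrite powRr1 ?divr_ge0 ?ltW//; field; by rewrite !gt_eqF.
Qed.

Let bqE : b * q = p `^ g^-1 * q `^ ((g - 1) / g).
Proof.
have -> : (g - 1) / g = 1 + - g^-1 by field; rewrite gt_eqF.
rewrite powRD ?(gt_eqF q0) ?implybT// (powRr1 (ltW q0)) /b.
rewrite powRM ?invr_ge0 ?ltW// -[q^-1]powR_inv1 ?ltW// -powRrM mulN1r.
by ring.
Qed.

(** Rescaling [x = b * t] by the maximizer [b] lets [pE] factor [b * q] out of both terms. What
    remains is the tangent-line bound at [t = 1] for the exponent [1 - g], with constant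
    [(1 - g)^-1 - 1 = g / (1 - g)]. *)
Lemma crra_conjugate_le x : 0 <= x ->
  ((- (x * q))%R%:E + p%:E * crra g x
    <= (g / (1 - g) * (p `^ g^-1 * q `^ ((g - 1) / g)))%:E)%E.
Proof.
rewrite -bqE le_eqVlt => /predU1P[<-|x0].
  (* At [x = 0] the left side is [-oo] if [1 < g]; if [g < 1] it is [0] and the right side is
     nonnegative. *)
  rewrite /crra eqxx/=; case: ltP => [g_gt1|g_le1].
    by rewrite gt0_muleNy ?lte_fin// addeNy leNye.
  rewrite powR0// !mul0r mule0 oppr0 adde0 lee_fin.
  have {}g_le1 : g < 1 by rewrite lt_neqAle g1.
  by rewrite mulr_ge0 ?divr_ge0 ?subr_ge0 ?mulr_ge0 ?ltW.
rewrite /crra gt_eqF//= -EFinM -EFinD lee_fin.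
have tx : x = b * (x / b) by field; rewrite gt_eqF.
have t0 : 0 < x / b by rewrite divr_gt0.
move: (x / b) tx t0 => t -> t0.
rewrite (powRM _ (ltW b0) (ltW t0)).
have -> : - (b * t * q) + p * (b `^ (1 - g) * t `^ (1 - g) / (1 - g)) =
  - (b * q * t) + (p * b `^ (1 - g)) * (t `^ (1 - g) / (1 - g)) by ring.
rewrite pE.
have T : t `^ (1 - g) / (1 - g) <= t + ((1 - g)^-1 - 1).
  by apply: powR_div_le_tangent => //; rewrite ltrBlDr ltrDl.
have : b * q * (t `^ (1 - g) / (1 - g)) <= b * q * (t + ((1 - g)^-1 - 1)).
  by rewrite ler_pM2l ?mulr_gt0.
have -> : g / (1 - g) = (1 - g)^-1 - 1 by field.
lra.
Qed.

Lemma crra_conjugate_attained :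
  ((- ((p / q) `^ g^-1 * q))%R%:E + p%:E * crra g ((p / q) `^ g^-1)
    = (g / (1 - g) * (p `^ g^-1 * q `^ ((g - 1) / g)))%:E)%E.
Proof.
rewrite -/b -bqE /crra gt_eqF//= -EFinM -EFinD; congr EFin.
by rewrite [p * (_ / _)]mulrA pE; field.
Qed.

End Crra.

End Real.

Section Orthant.
Context {R : realType} {n : nat}.
Implicit Types (c q u k : 'cV[R]_n) (g mu : R) (p : 'I_n -> R).

Lemma hamiltonianE g p q : 0 < g -> g != 1 -> (forall i, 0 < p i) ->
  pos_orthant q ->
  hamiltonian g p q =
  (g / (1 - g) * \sum_i p i `^ g^-1 * q i 0 `^ ((g - 1) / g))%:E.
Proof.
move=> g0 g1 p0 q0.
have split_sum c : ((- inner c q)%R%:E + \sum_i (p i)%:E * crra g (c i 0%R) =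
    \sum_i ((- (c i 0%R * q i 0%R))%R%:E + (p i)%:E * crra g (c i 0%R)))%E.
  by rewrite big_split/= /inner -sumrN -sumEFin.
rewrite mulr_sumr -sumEFin; apply/eqP; rewrite eq_le; apply/andP; split.
  apply: ge_ereal_sup => _ [c c0 <-]; rewrite split_sum.
  by apply: lee_sum => i _; exact: crra_conjugate_le.
apply: ereal_sup_ubound; exists (\col_i (p i / q i 0) `^ g^-1).
  by move=> i; rewrite mxE powR_ge0.
rewrite split_sum; apply: eq_bigr => i _; rewrite mxE.
exact: crra_conjugate_attained.
Qed.

Lemma innerZr a k u : inner k (a *: u) = a * inner k u.
Proof. by rewrite mulr_sumr; apply: eq_bigr => i _; rewrite mxE mulrCA. Qed.

Lemma inner_mulmx (M : 'M[R]_n) k u : inner (M *m k) u = inner k (M^T *m u).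
Proof.
rewrite /inner.
under eq_bigr do rewrite mxE mulr_suml.
rewrite exchange_big; apply: eq_bigr => j _; rewrite mxE mulr_sumr.
by apply: eq_bigr => i _; rewrite mxE; ring.
Qed.

Lemma inner_gt0 k u : (0 < n)%N -> pos_orthant k -> pos_orthant u ->
  0 < inner k u.
Proof.
move=> n0 k0 u0; rewrite /inner (bigD1 (Ordinal n0))//=.
rewrite ltr_pwDl ?mulr_gt0//.
by apply: sumr_ge0 => i _; rewrite mulr_ge0 ?ltW.
Qed.

Lemma is_linear_inner u : linear (fun k => inner k u : R).
Proof.
move=> a x y; rewrite /inner scaler_sumr -big_split; apply: eq_bigr => i _.
by rewrite !mxE mulrDl scalerAl.
Qed.

Lemma continuous_inner u : continuous (fun k => inner k u : R).
Proof.
apply: continuous_big => [|i _ k]; first exact: add_continuous.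
by apply: continuousM; [exact: coord_continuous|exact: cst_continuous].
Qed.

Lemma is_diff_inner u k : is_diff k (fun k => inner k u : R) (fun k => inner k u : R).
Proof.
(* Bundled as a linear map, the pairing is its own differential once it is known to be
   continuous. *)
pose l : {linear 'cV[R]_n -> R} :=
  HB.pack (fun k => inner k u : R) (GRing.isLinear.Build _ _ _ _ _ (is_linear_inner u)).
have lc : continuous l by exact: continuous_inner.
rewrite -[fun k => _]/(l : _ -> _).
by apply: DiffDef; [exact: linear_differentiable|rewrite diff_lin].
Qed.

Lemma inner_delta i u : inner (delta_mx i 0) u = u i 0.
Proof.
rewrite /inner (bigD1 i)//= mxE !eqxx mul1r big1 ?addr0// => j ji.
by rewrite mxE (negbTE ji) mul0r.
Qed.

(** Chain rule for the power of a linear form; the differential is left in the unsimplified shape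
    that this rule produces. *)
Lemma is_diff_candidate_value g mu u k : 0 < inner k u ->
  is_diff k (candidate_value g mu u)
    (fun h => (1 - g)^-1 * (g / (mu * (1 - g))) `^ g *
       (inner h u * ((1 - g) * inner k u `^ (1 - g - 1)))).
Proof.
move=> s0; have pd := is_derive1_powR (1 - g) s0.
have dp : differentiable (@powR R ^~ (1 - g)) (inner k u).
  by apply/derivable1_diffP; exact: ex_derive.
have is_dp : is_diff (inner k u) (@powR R ^~ (1 - g))
    (fun h => h * ((1 - g) * inner k u `^ (1 - g - 1))).
  apply: DiffDef => //; rewrite diff1E//; apply/funext => h.
  by rewrite derive1E derive_val.
have := is_diff_comp (is_diff_inner u k) is_dp.
exact: is_diffZ.
Qed.

Lemma gradient_candidate_value g mu u k : g != 1 -> 0 < inner k u ->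
  gradient (candidate_value g mu u) k =
  ((g / (mu * (1 - g))) `^ g * inner k u `^ (- g)) *: u.
Proof.
move=> g1 s0; have vd := is_diff_candidate_value g mu _ _ s0.
apply/colP => i; rewrite !mxE deriveE; last exact: ex_diff.
rewrite diff_val inner_delta.
have -> : 1 - g - 1 = - g by ring.
by field; rewrite subr_eq0 eq_sym.
Qed.

Lemma C1_on_candidate_value g mu u : g != 1 -> (0 < n)%N -> pos_orthant u ->
  C1_on (@pos_orthant R n) (candidate_value g mu u).
Proof.
move=> g1 n0 u0; split => [k k0|].
  have vd := is_diff_candidate_value g mu _ _ (inner_gt0 _ _ n0 k0 u0).
  exact: ex_diff.
(* The closed form of the gradient is established only where [inner k u] is positive. Continuity
   within the orthant is therefore transferred from [G], which is differentiable at each point of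
   it. *)
pose G k := ((g / (mu * (1 - g))) `^ g * inner k u `^ (- g)) *: u.
apply: (@subspace_eq_continuous _ _ _ (G : subspace _ -> _)) => [k|].
  by rewrite inE => k0; apply/esym/gradient_candidate_value => //; exact: inner_gt0.
apply: continuous_in_subspaceT => k; rewrite inE => k0.
have s0 := inner_gt0 _ _ n0 k0 u0.
apply: differentiable_continuous; apply: differentiableZl.
apply: differentiableM => //.
apply: (@differentiable_comp _ _ _ _ (fun x => inner x u : R) (@powR R ^~ (- g))).
  have ud := is_diff_inner u k; exact: ex_diff.
apply/derivable1_diffP; have pd := is_derive1_powR (- g) s0; exact: ex_derive.
Qed.

(** Allows the operator in the drift term to pass from [k] to [u], where the eigenvalue equation
    applies. *)
Lemma trmx_laplacian_diag (W : 'M[R]_n) (a : 'I_n -> R) : W^T = W ->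
  (graph_laplacian W + diag_of a)^T = graph_laplacian W + diag_of a.
Proof.
move=> Wsym; rewrite linearD/= tr_diag_mx; congr (_ + _).
apply/matrixP => i j; rewrite !mxE eq_sym; case: eqP => [->//|_].
by rewrite -[in LHS]Wsym mxE.
Qed.

End Orthant.

Theorem proposition5p5 (R : realType) (n : nat) (rho gamma mu : R)
    (p a : 'I_n -> R) (W : 'M[R]_n) (u : 'cV[R]_n)
    (hn : (2 <= n)%N) (hrho : 0 < rho)
    (hgamma : 0 < gamma) (hgamma1 : gamma != 1)
    (hp : forall i, 0 < p i) (ha : forall i, 0 < a i)
    (hW : graph_weights W) (hu : pos_orthant u)
    (hmu : 0 < mu * (1 - gamma))
    (hL : graph_irreducible W)
    (hsol : eigen_solution rho gamma p a W mu u) :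
  HJB_classical_solution rho gamma p a W (candidate_value gamma mu u).
Proof.
have n0 : (0 < n)%N by exact: leq_trans hn.
split; first exact: C1_on_candidate_value.
move=> k hk; have s0 := inner_gt0 _ _ n0 hk hu.
have [Wsym _ _] := hW.
rewrite gradient_candidate_value//.
set B := gamma / (mu * (1 - gamma)); set s := inner k u.
have B0 : 0 < B by rewrite divr_gt0.
have sub0 : 1 - gamma != 0 by rewrite subr_eq0 eq_sym.
have mu0 : mu != 0 by apply: contraTneq hmu => ->; rewrite mul0r ltxx.
set q := B `^ gamma * s `^ (- gamma).
have q0 : 0 < q by rewrite mulr_gt0 ?powR_gt0.
rewrite hamiltonianE//; last by move=> i; rewrite mxE mulr_gt0.
rewrite -EFinD; congr EFin.
rewrite innerZr inner_mulmx trmx_laplacian_diag// hsol innerZr -/s.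
have -> : \sum_i p i `^ gamma^-1 * (q *: u) i 0 `^ ((gamma - 1) / gamma) =
    q `^ ((gamma - 1) / gamma) * Phi gamma p u.
  rewrite mulr_sumr; apply: eq_bigr => i _.
  by rewrite mxE powRM ?ltW// mulrCA.
(* Every power is reduced to [B]^ gamma[and]s [^ (- gamma)], so that the equation becomes rational
   in these two quantities. *)
have sE : s `^ (1 - gamma) = s * s `^ (- gamma).
  by rewrite powRD ?(gt_eqF s0) ?implybT// (powRr1 (ltW s0)).
have -> : q `^ ((gamma - 1) / gamma) = B `^ gamma / B * s `^ (1 - gamma).
  rewrite powRM ?powR_ge0// -!powRrM.
  have -> : gamma * ((gamma - 1) / gamma) = gamma - 1 by field; rewrite gt_eqF.
  have -> : - gamma * ((gamma - 1) / gamma) = 1 - gamma by field; rewrite gt_eqF.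
  by rewrite powRB ?(gt_eqF B0) ?implybT// (powRr1 (ltW B0)).
rewrite /candidate_value -/B -/s sE /q.
move: (B `^ gamma) (s `^ (- gamma)) (Phi _ _ _) => X Y F.
(* Unfolding the remaining [B] gives [gamma / (1 - gamma) / B = mu], which cancels the two terms in
   [F]. *)
rewrite /B; field.
by rewrite sub0 mu0 gt_eqF.
Qed.
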